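(* Let $W=\mathbb{Q}$ (one-dimensional, even) with its standard nondegenerate symmetric form, and let $V=\Pi W$, so that $V^*$ is spanned by one odd element $t$ and $V$ carries an even form. Then the solutions of the quantum master equation $d(f)+\frac12[f,f]=0$ (with $f$ even) in the differential graded Lie algebra $\Lambda_\gamma[V]$ are exactly the elements $$\sum_{i=0}^\infty\sum_{k=1}^\infty\sum_{r_1,\ldots,r_k=0}^\infty a^i_{r_1,\ldots,r_k}\,\gamma^i\,(t^{2r_1+1}\wedge\cdots\wedge t^{2r_k+1}),$$ where the coefficients $a^i_{r_1,\ldots,r_k}\in\mathbb{Q}$ are arbitrary (apart from $a^0_{0}=0$, the corresponding term $t$ not lying in $\Lambda_\gamma[V]$). In particular, every cyclic $A_\infty$-structure $h=\sum_{r\ge1}a_r t^{2r+1}\in\mathfrak{h}_{\ge2}[V]$ on $W$ extends to a solution of the quantum master equation in $\Lambda_\gamma[V]$.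
   Context: All spaces are over $\mathbb{Q}$ and $\mathbb{Z}/2\mathbb{Z}$-graded; $\Pi$ is parity reversion. $\mathfrak h=\mathfrak h[V]:=\prod_{n\ge0}[(V^* )^{\otimes n}]_{\mathbb Z/n\mathbb Z}$ is the space of cyclic words in $V^*$, where the cyclic group acts with Koszul signs; $\mathfrak h_{\ge i}$ is the part of words of length $\ge i$. The class of $t^{\otimes n}$ is denoted $t^n$ (the generator of $\mathbb Z/n\mathbb Z$ acts on $t^{\otimes n}$ by $(-1)^{n-1}$). For $V$ with an even nondegenerate skew-symmetric form, with dual form $\langle-,-\rangle^{-1}$ on $V^*$ (here $\langle t,t\rangle^{-1}=1$), $\mathfrak h$ is an involutive Lie bialgebra with even bracket $$\{a_1\cdots a_n,b_1\cdots b_m\}=\sum_{i,j}\pm\langle a_i,b_j\rangle^{-1}\,a_{i+1}\cdots a_na_1\cdots a_{i-1}\,b_{j+1}\cdots b_mb_1\cdots b_{j-1}$$ and cobracket $$\Delta(a_1\cdots a_n)=\sum_{i<j}\pm\langle a_i,a_j\rangle^{-1}\,(a_{i+1}\cdots a_{j-1})\wedge(a_{j+1}\cdots a_na_1\cdots a_{i-1}),$$ with Koszul signs. Equivalently $\Pi\mathfrak h$ has an odd bracket and odd cobracket, and below $\Pi\mathfrak h$ is used, so that $\widehat S(\Pi\mathfrak h)$ is the completed exterior algebra of $\mathfrak h$, with product written $\wedge$. The element of $\Pi\mathfrak h$ given by a word $t^{2r+1}$ is even; parity of elements of $\widehat S(\Pi\mathfrak h)$ is taken accordingly. On $\widehat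 S(\Pi\mathfrak h)=\prod_n((\Pi\mathfrak h)^{\hat\otimes n})_{S_n}$ let $\delta(g_1\cdots g_n)=\sum_{i<j}\pm\{g_i,g_j\}g_1\cdots\hat g_i\cdots\hat g_j\cdots g_n$ (Koszul signs), extend $\Delta$ as a derivation, and extend the bracket to $[-,-]$ by the Leibniz rule. Then $\widehat S(\Pi\mathfrak h)\hat\otimes\mathbb Q[[\gamma]]$, $\gamma$ even, with differential $d=\gamma\delta+\Delta$ is a differential graded Lie algebra (odd bracket). Let $\nu$ denote the (odd) element given by the empty word. Quotienting by the ideal generated by constants (series in $\gamma$ and $\nu$ alone) and setting $\nu=0$ gives an induced differential graded Lie algebra structure on $\widehat S^{\ge1}(\Pi\mathfrak h_{\ge1})\hat\otimes\mathbb Q[[\gamma]]$. $\Lambda_\gamma[V]$ is its differential graded Lie subalgebra of elements of order $\ge2$, where $\gamma$ has order 1 and a cyclic word of length $i$ has order $i$; i.e. the component on a single word of length 1 without factor $\gamma$ must vanish. A cyclic $A_\infty$-structure on $W$ is an odd element $h\in\mathfrak h_{\ge2}[V]$ with $\{h,h\}=0$. ''Extends'' means that $h$ is the image of the solution under the map $\Lambda_\gamma[V]\to\mathfrak h_{\ge2}[V]$ setting $\gamma=0$ and projecting onto single words of length $\ge2$. *)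

(* Defs.v *)
From HB Require Import structures.
From mathcomp Require Import all_boot all_order all_algebra.
From mathcomp Require Import boolp classical_sets functions cardinality fsbigop.
From mathcomp Require Import zify.

Set Implicit Arguments.
Unset Strict Implicit.
Unset Printing Implicit Defensive.

Import GRing.Theory.
Local Open Scope classical_set_scope.
Local Open Scope ring_scope.

(** * Superspaces with a form

    A finite-dimensional superspace over Q is given by a homogeneous basis
    [e_0, ..., e_(n-1)] with parities [par] ([true] = odd); a bilinear form is
    given by its Gram matrix in that basis. *)

(* Even nondegenerate (super)symmetric form. *)
Record quadSpace := QuadSpace {
  qdim : nat;
  qpar : 'I_qdim -> bool;
  qform : 'M[rat]_qdim;
  qform_even : forall i j, qpar i != qpar j -> qform i j = 0;
  qform_sym : forall i j, qform i j = (-1) ^+ (qpar i && qpar j) * qform j i;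
  qform_nondeg : qform \in unitmx }.

(* Even nondegenerate (super)skew-symmetric form. *)
Record sympSpace := SympSpace {
  sdim : nat;
  spar : 'I_sdim -> bool;
  sform : 'M[rat]_sdim;
  sform_even : forall i j, spar i != spar j -> sform i j = 0;
  sform_skew : forall i j,
    sform i j = - ((-1) ^+ (spar i && spar j) * sform j i);
  sform_nondeg : sform \in unitmx }.

Section ParityReversion.
Variable W : quadSpace.

Definition Pi_par (i : 'I_(qdim W)) : bool := ~~ qpar i.

(* <Pi v, Pi w> = (-1)^|v| <v, w> *)
Definition Pi_form : 'M[rat]_(qdim W) :=
  \matrix_(i, j) ((-1) ^+ qpar i * qform W i j).

Lemma Pi_form_even i j : Pi_par i != Pi_par j -> Pi_form i j = 0.
Proof.
rewrite /Pi_par mxE => hij; rewrite qform_even ?mulr0 //.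
by apply: contra hij => /eqP ->.
Qed.

Lemma Pi_form_skew i j :
  Pi_form i j = - ((-1) ^+ (Pi_par i && Pi_par j) * Pi_form j i).
Proof.
have [hij|hij] := eqVneq (qpar i) (qpar j); last first.
  by rewrite !mxE (qform_even hij) qform_even 1?eq_sym // !mulr0 oppr0.
rewrite !mxE (qform_sym i j) /Pi_par hij.
by case: (qpar j); rewrite /= ?expr0 ?expr1 ?mul1r ?mulN1r ?opprK.
Qed.

Lemma Pi_form_nondeg : Pi_form \in unitmx.
Proof.
have -> : Pi_form = diag_mx (\row_i (-1) ^+ qpar i) *m qform W.
  by apply/matrixP=> i j; rewrite mul_diag_mx !mxE.
rewrite unitmx_mul qform_nondeg andbT unitmxE det_diag unitfE.
by apply/prodf_neq0 => i _; rewrite mxE signr_eq0.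
Qed.

Definition Pi : sympSpace :=
  SympSpace Pi_form_even Pi_form_skew Pi_form_nondeg.

End ParityReversion.

(** * Koszul signs *)

(* Sign of the reordering [x_(s_0) x_(s_1) ...] of [x_0 x_1 ...], where [x_k]
   has parity [nth false p k] and [s] lists indices without repetition: one
   factor -1 for each pair of odd symbols whose order is reversed. *)
Fixpoint koszul (p : seq bool) (s : seq nat) : rat :=
  if s is x :: s' then
    (-1) ^+ count (fun y => [&& y < x, nth false p x & nth false p y]%N) s'
      * koszul p s'
  else 1.

(* [cut i x] is [x_(i+1) ... x_(n-1) x_0 ... x_(i-1)]: the cyclic sequence [x]
   opened at its deleted entry [i]. *)
Definition cut (T : Type) (i : nat) (s : seq T) : seq T :=
  drop i.+1 s ++ take i s.

(* For [i < j]: [x_(i+1) ... x_(j-1)] and [x_(j+1) ... x_(n-1) x_0 ... x_(i-1)]. *)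
Definition inner (T : Type) (i j : nat) (s : seq T) : seq T :=
  take (j - i.+1) (drop i.+1 s).
Definition outer (T : Type) (i j : nat) (s : seq T) : seq T :=
  drop j.+1 s ++ take i s.

Definition del (T : Type) (i : nat) (s : seq T) : seq T :=
  take i s ++ drop i.+1 s.

(** * Closed subspaces of products

    All the spaces below are of the form [(X -> Q) / J]: formal, possibly
    infinite, combinations of elements of a set [X], modulo the closed subspace
    generated by homogeneous relators. There are finitely many elements of [X]
    of weight [< N], so that [closed_span] is the product over the homogeneous
    components of the spans of the relators. *)

Section ClosedSpan.
Variables (X : eqType) (wt : X -> nat) (R : (X -> rat) -> Prop).

Definition single (x : X) : X -> rat := fun y => (y == x)%:R.

Inductive span : (X -> rat) -> Prop :=
| span_zero : span (fun=> 0)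
| span_add c r g : R r -> span g -> span (fun x => c * r x + g x).

Definition closed_span (f : X -> rat) : Prop :=
  forall N, exists2 g, span g & forall x, (wt x < N)%N -> f x = g x.

End ClosedSpan.

Section CyclicWords.
Variable V : sympSpace.

(* Letters are the elements of the basis of V^* dual to that of V; they have
   the parities of the corresponding basis elements of V. *)
Definition letter := 'I_(sdim V).
Definition word := seq letter.

Definition ltr (w : word) (i : 'I_(size w)) : letter := tnth (in_tuple w) i.

(* Gram matrix, in the dual basis, of the form on V^* obtained from the form on
   V by means of the isomorphism V -> V^*, v |-> <v, ->. *)
Definition dual_form : 'M[rat]_(sdim V) := (invmx (sform V))^T.

Definition pars (w : word) : seq bool := [seq spar x | x <- w].
Definition wpar (w : word) : bool := odd (count id (pars w)).

(** ** The space h of cyclic words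

    Elements of h are represented by functions [word -> rat]. *)

Inductive rotation_rel : (word -> rat) -> Prop :=
| RotationRel (x : letter) (w : word) : rotation_rel (fun u =>
    single (x :: w) u - (-1) ^+ (spar x && wpar w) * single (rcons w x) u).

Definition h_eq (g h : word -> rat) : Prop :=
  closed_span size rotation_rel (fun w => g w - h w).

Definition h_odd (h : word -> rat) : Prop :=
  exists2 g, h_eq h g & forall w, g w != 0 -> wpar w.

Definition h_ge (n : nat) (h : word -> rat) : Prop :=
  exists2 g, h_eq h g & forall w, g w != 0 -> (n <= size w)%N.

(* The bracket {a, b} of two words, and its bilinear extension; the sum has
   finite support by [finite_bracket]. *)
Definition bracket (a b : word) : word -> rat := fun w =>
  \sum_(i < size a) \sum_(j < size b)
    koszul (pars (a ++ b))
      [:: nat_of_ord i, (size a + j)%N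
        & cut i (iota 0 (size a)) ++ cut j (iota (size a) (size b))]
    * dual_form (ltr i) (ltr j) * single (cut i a ++ cut j b) w.

Definition h_bracket (g h : word -> rat) : word -> rat := fun w =>
  \sum_(p \in [set: word * word]) g p.1 * h p.2 * bracket p.1 p.2 w.

(* The cobracket of a word; [(u, v)] stands for the element u /\ v of the
   exterior square of h. *)
Definition cobracket (a : word) : word * word -> rat := fun uv =>
  \sum_(i < size a) \sum_(j < size a | (i < j)%N)
    koszul (pars a)
      [:: nat_of_ord i, nat_of_ord j
        & inner i j (iota 0 (size a)) ++ outer i j (iota 0 (size a))]
    * dual_form (ltr i) (ltr j) * single (inner i j a, outer i j a) uv.

(** ** Parity reversion

    The odd structure on [Pi h]:
    {Pi a, Pi b} = (-1)^|a| Pi {a, b}, which is graded symmetric, and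
    u /\ v |-> (-1)^|u| (Pi u)(Pi v), which sends the exterior square of h to
    the symmetric square of [Pi h]. *)

Definition Pi_wpar (w : word) : bool := ~~ wpar w.

Definition Pi_bracket (a b : word) : word -> rat := fun w =>
  (-1) ^+ wpar a * bracket a b w.

Definition Pi_cobracket (a : word) : word * word -> rat := fun uv =>
  (-1) ^+ wpar uv.1 * cobracket a uv.

(** ** The completed symmetric algebra of [Pi h], tensored with Q[[gamma]]

    The monomial [(i, [:: w_1; ...; w_k])] stands for
    gamma^i (w_1 /\ ... /\ w_k), and an element is represented by a function
    [mono -> rat]. *)

Definition mono := (nat * seq word)%type.
Definition series := mono -> rat.

Definition tot_len (ws : seq word) : nat := sumn (map size ws).
Definition mono_weight (m : mono) : nat := (m.1 + size m.2 + tot_len m.2)%N.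

Definition mpar (ws : seq word) : bool := odd (count Pi_wpar ws).

(* The maps delta and Delta on w_1 /\ ... /\ w_k. Both, and the bracket [-,-],
   are odd operators: the arguments are first brought to the front, so that no
   further sign arises. *)
Definition mono_delta (ws : seq word) : seq word -> rat := fun us =>
  if us is u :: us' then
    \sum_(i < size ws) \sum_(j < size ws | (i < j)%N)
      koszul (map Pi_wpar ws)
        [:: nat_of_ord i, nat_of_ord j & del i (del j (iota 0 (size ws)))]
      * Pi_bracket (nth [::] ws i) (nth [::] ws j) u
      * single (del i (del j ws)) us'
  else 0.

Definition mono_Delta (ws : seq word) : seq word -> rat := fun us =>
  if us is [:: u, v & us'] then
    \sum_(i < size ws)
      koszul (map Pi_wpar ws) (nat_of_ord i :: del i (iota 0 (size ws)))
      * Pi_cobracket (nth [::] ws i) (u, v) * single (del i ws) us'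
  else 0.

Definition mono_bracket (ws vs : seq word) : seq word -> rat := fun us =>
  if us is u :: us' then
    \sum_(i < size ws) \sum_(j < size vs)
      koszul (map Pi_wpar (ws ++ vs))
        [:: nat_of_ord i, (size ws + j)%N
          & del i (iota 0 (size ws)) ++ del j (iota (size ws) (size vs))]
      * Pi_bracket (nth [::] ws i) (nth [::] vs j) u
      * single (del i ws ++ del j vs) us'
  else 0.

(* Coefficient of [m] in [d n], for d = gamma delta + Delta. *)
Definition mono_d (n m : mono) : rat :=
  (m.1 == n.1.+1)%:R * mono_delta n.2 m.2 + (m.1 == n.1)%:R * mono_Delta n.2 m.2.

(* Coefficient of [m] in [n, n']. *)
Definition mono_br (n n' m : mono) : rat :=
  (m.1 == n.1 + n'.1)%N%:R * mono_bracket n.2 n'.2 m.2.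

(* The sums have finite support: see [finite_mono_d] and [finite_mono_br]. *)
Definition d (f : series) : series := fun m =>
  \sum_(n \in [set: mono]) f n * mono_d n m.

Definition br (f g : series) : series := fun m =>
  \sum_(p \in [set: mono * mono]) f p.1 * g p.2 * mono_br p.1 p.2 m.

(* The first two kinds of relators are those of the coinvariants; the last two
   set to zero the empty word nu, and the constants (the series in gamma and nu
   alone). *)
Inductive series_rel : series -> Prop :=
| SeriesRotation i us x w vs : series_rel (fun m =>
    single (i, us ++ (x :: w) :: vs) m
    - (-1) ^+ (spar x && wpar w) * single (i, us ++ rcons w x :: vs) m)
| SeriesSwap i us v w vs : series_rel (fun m =>
    single (i, us ++ [:: v, w & vs]) m
    - (-1) ^+ (Pi_wpar v && Pi_wpar w) * single (i, us ++ [:: w, v & vs]) m)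
| SeriesNu (i : nat) (ws : seq word) : [::] \in ws ->
    series_rel (fun m => single (i, ws) m)
| SeriesConst (i : nat) (ws : seq word) : all (@nilp letter) ws ->
    series_rel (fun m => single (i, ws) m).

(* Equality in the quotient differential graded Lie algebra, the completed
   S^{>=1}(Pi h_{>=1}) tensored with Q[[gamma]]. *)
Definition series_eq (f g : series) : Prop :=
  closed_span mono_weight series_rel (fun m => f m - g m).

Definition series_even (f : series) : Prop :=
  exists2 g, series_eq f g & forall m, g m != 0 -> ~~ mpar m.2.

Definition order (m : mono) : nat := (m.1 + tot_len m.2)%N.

Definition in_Lambda (f : series) : Prop :=
  exists2 g, series_eq f g & forall m, g m != 0 -> (2 <= order m)%N.

Definition quantum_master_eq (f : series) : Prop :=
  series_eq (fun m => d f m + 2%:R^-1 * br f f m) (fun=> 0).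

Definition QME_solution (f : series) : Prop :=
  [/\ in_Lambda f, series_even f & quantum_master_eq f].

(* The map to h_{>=2}: set gamma = 0 and keep the single words of length >= 2. *)
Definition Lambda_to_h (f : series) : word -> rat := fun w =>
  if (2 <= size w)%N then f (0%N, [:: w]) else 0.

(** ** Local finiteness of the structure maps *)

Lemma size_del (T : Type) i (s : seq T) :
  (i < size s)%N -> (size (del i s)).+1 = size s.
Proof.
by move=> hi; rewrite size_cat size_take size_drop hi; lia.
Qed.

Lemma size_cut (T : Type) i (s : seq T) :
  (i < size s)%N -> (size (cut i s)).+1 = size s.
Proof. by move=> hi; rewrite -(size_del hi) !size_cat addnC. Qed.

Lemma size_inner_outer (T : Type) i j (s : seq T) : (i < j)%N ->
  (j < size s)%N -> (size (inner i j s) + size (outer i j s)).+2 = size s.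
Proof.
move=> ij js; rewrite /inner /outer size_take size_cat !size_drop size_take.
by rewrite (ltn_trans ij js); case: ifP; lia.
Qed.

Lemma tot_len_del i (ws : seq word) : (i < size ws)%N ->
  (size (nth [::] ws i) + tot_len (del i ws))%N = tot_len ws.
Proof.
move=> hi; rewrite /tot_len /del map_cat sumn_cat.
rewrite -[in RHS](cat_take_drop i ws) (drop_nth [::] hi) map_cat sumn_cat /=.
by rewrite addnCA.
Qed.

Lemma nth_del i j (ws : seq word) : (i < j)%N -> (j < size ws)%N ->
  nth [::] (del j ws) i = nth [::] ws i.
Proof. by move=> ij hj; rewrite /del nth_cat size_take hj ij nth_take. Qed.

Lemma sumr_neq0 (I : finType) (P : pred I) (F : I -> rat) :
  \sum_(i | P i) F i != 0 -> exists2 i, P i & F i != 0.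
Proof.
move=> h; have [/existsP[i /andP[Pi Fi]]|/existsPn h0] :=
  boolP [exists i, P i && (F i != 0)]; first by exists i.
rewrite big1 ?eqxx // in h => i Pi.
by have := h0 i; rewrite Pi /= negbK => /eqP.
Qed.

Lemma single_neq0 (X : eqType) (x y : X) : single x y != 0 -> y = x.
Proof. by rewrite /single; case: (y =P x) => //; rewrite eqxx. Qed.

Lemma bracket_size (a b w : word) : bracket a b w != 0 ->
  (size a + size b = (size w).+2)%N.
Proof.
case/sumr_neq0 => i _ /sumr_neq0[j _].
rewrite mulf_eq0 negb_or => /andP[_ /single_neq0 ->].
have hi := size_cut (ltn_ord i); have hj := size_cut (ltn_ord j).
by rewrite size_cat; lia.
Qed.

Lemma cobracket_size (a u v : word) : cobracket a (u, v) != 0 ->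
  (size a = (size u + size v).+2)%N.
Proof.
case/sumr_neq0 => i _ /sumr_neq0[j ij].
rewrite mulf_eq0 negb_or => /andP[_ /single_neq0 [-> ->]].
by rewrite size_inner_outer.
Qed.

Lemma mono_delta_size (ws us : seq word) : mono_delta ws us != 0 ->
  size ws = (size us).+1 /\ tot_len ws = (tot_len us).+2.
Proof.
case: us => [|u us] //=.
case/sumr_neq0 => i _ /sumr_neq0[j ij].
rewrite mulf_eq0 negb_or => /andP[+ /single_neq0 ->].
rewrite mulf_eq0 negb_or => /andP[_].
rewrite mulf_eq0 negb_or => /andP[_ /bracket_size hs].
have hj := size_del (ltn_ord j).
have hi : (i < size (del j ws))%N by rewrite -ltnS hj (leq_ltn_trans ij).
have si := size_del hi; have tj := tot_len_del (ltn_ord j).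
have := tot_len_del hi; rewrite nth_del // => ti.
by move: ti tj; rewrite /tot_len /=; split; lia.
Qed.

Lemma mono_Delta_size (ws us : seq word) : mono_Delta ws us != 0 ->
  (size ws).+1 = size us /\ tot_len ws = (tot_len us).+2.
Proof.
case: us => [|u [|v us]] //=.
case/sumr_neq0 => i _.
rewrite mulf_eq0 negb_or => /andP[+ /single_neq0 ->].
rewrite mulf_eq0 negb_or => /andP[_].
rewrite mulf_eq0 negb_or => /andP[_ /cobracket_size hs].
have si := size_del (ltn_ord i); have := tot_len_del (ltn_ord i).
by rewrite /tot_len /=; split; lia.
Qed.

Lemma mono_bracket_size (ws vs us : seq word) : mono_bracket ws vs us != 0 ->
  (size ws + size vs = (size us).+1)%N /\
  (tot_len ws + tot_len vs = (tot_len us).+2)%N.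
Proof.
case: us => [|u us] //=.
case/sumr_neq0 => i _ /sumr_neq0[j _].
rewrite mulf_eq0 negb_or => /andP[+ /single_neq0 ->].
rewrite mulf_eq0 negb_or => /andP[_].
rewrite mulf_eq0 negb_or => /andP[_ /bracket_size hs].
have hi := size_del (ltn_ord i); have hj := size_del (ltn_ord j).
have ti := tot_len_del (ltn_ord i); have tj := tot_len_del (ltn_ord j).
rewrite size_cat [tot_len (_ :: _)]/= /tot_len /= map_cat sumn_cat.
by move: ti tj; rewrite /tot_len; split; lia.
Qed.

Lemma finite_seq_le (T : choiceType) (A : set T) N : finite_set A ->
  finite_set [set s : seq T | (size s <= N)%N /\ forall x, x \in s -> A x].
Proof.
move=> fA; elim: N => [|N IH].
  apply: (@sub_finite_set _ _ [set [::]]) => [[|x s] [] //|].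
  exact: finite_set1.
apply: (@sub_finite_set _ _ ([set [::]] `|`
  [set x :: s | x in A & s in
    [set s : seq T | (size s <= N)%N /\ forall x, x \in s -> A x]])); last first.
  by rewrite finite_setU; split; [exact: finite_set1|exact: finite_image2].
case=> [|x s] [/= hs hA]; [by left|right].
exists x; first by apply: hA; rewrite mem_head.
by exists s => //; split=> // y ys; apply: hA; rewrite in_cons ys orbT.
Qed.

Lemma finite_bracket (w : word) :
  finite_set [set p : word * word | bracket p.1 p.2 w != 0].
Proof.
have f := @finite_seq_le letter setT (size w).+2 finite_finset.
apply: (sub_finite_set _ (finite_setX f f)) => -[a b] /= /bracket_size hs.
by split; split=> [|x _] //=; rewrite -hs ?leq_addr ?leq_addl.
Qed.

Lemma finite_mono_weight N : finite_set [set m | (mono_weight m <= N)%N].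
Proof.
have f1 := @finite_seq_le letter setT N finite_finset.
have f2 := finite_seq_le N f1.
apply: (sub_finite_set _ (finite_setX (finite_II N.+1) f2)) => -[i ws] /= hN.
split; first by rewrite ltnS (leq_trans _ hN) // /mono_weight -addnA leq_addr.
split=> [|w hw]; first by rewrite (leq_trans _ hN) // /mono_weight addnAC leq_addl.
split=> //; apply: leq_trans hN; apply: leq_trans (leq_addl _ _).
by move/perm_to_rem/(perm_map size)/perm_sumn: hw; rewrite /tot_len => -> /=;
  rewrite leq_addr.
Qed.

Lemma finite_mono_d (m : mono) : finite_set [set n | mono_d n m != 0].
Proof.
apply: (sub_finite_set _ (finite_mono_weight (mono_weight m).+2)) => n /=.
rewrite /mono_d /mono_weight.
have [->|/mono_delta_size[h1 h2]] := eqVneq (mono_delta n.2 m.2) 0.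
  have [->|/mono_Delta_size[h1 h2]] := eqVneq (mono_Delta n.2 m.2) 0.
    by rewrite !mulr0 addr0 eqxx.
  have [e _|_] := eqVneq m.1 n.1; first by lia.
  by rewrite mulr0 mul0r addr0 eqxx.
have [e _|_] := eqVneq m.1 n.1.+1; first by lia.
have [->|/mono_Delta_size[h3 h4]] := eqVneq (mono_Delta n.2 m.2) 0; last by lia.
by rewrite mul0r mulr0 addr0 eqxx.
Qed.

Lemma finite_mono_br (m : mono) :
  finite_set [set p : mono * mono | mono_br p.1 p.2 m != 0].
Proof.
have f := finite_mono_weight (mono_weight m).+3.
apply: (sub_finite_set _ (finite_setX f f)) => -[n n'] /=.
rewrite /mono_br; have [e|_] := eqVneq m.1 (n.1 + n'.1)%N; last first.
  by rewrite mul0r eqxx.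
rewrite mul1r => /mono_bracket_size[h1 h2].
by rewrite /mono_weight; split; lia.
Qed.

End CyclicWords.

Definition cyclic_Ainfty (W : quadSpace) (h : word (Pi W) -> rat) : Prop :=
  [/\ h_odd h, h_ge 2 h & h_eq (h_bracket h h) (fun=> 0)].

(** * The line Q with its standard form *)

Lemma line_even (i j : 'I_1) : false != false -> (1%:M : 'M[rat]_1) i j = 0.
Proof. by []. Qed.

Lemma line_sym (i j : 'I_1) :
  (1%:M : 'M[rat]_1) i j = (-1) ^+ (false && false) * (1%:M : 'M[rat]_1) j i.
Proof. by rewrite mul1r (ord1 i) (ord1 j). Qed.

Definition line : quadSpace :=
  @QuadSpace 1 (fun=> false) 1%:M line_even line_sym (unitmx1 _ _).

Definition t : letter (Pi line) := (ord0 : 'I_1).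

Lemma t_odd : spar t = true. Proof. by []. Qed.

Lemma dual_form_t : dual_form (Pi line) t t = 1.
Proof.
suff -> : dual_form (Pi line) = 1%:M by rewrite mxE.
have -> : dual_form (Pi line) = (invmx (1%:M : 'M[rat]_1))^T.
  rewrite /dual_form; congr (invmx _)^T.
  by apply/matrixP => i j; rewrite !mxE mul1r.
by rewrite invmx1 trmx1.
Qed.

Definition t_pow (r : nat) : word (Pi line) := nseq r.*2.+1 t.

(* Main.v *)
Require Import Defs.
From mathcomp Require Import all_boot all_order all_algebra.
From mathcomp Require Import boolp classical_sets functions cardinality fsbigop.
From mathcomp Require Import zify.

(** With a single odd letter [t], a word [t^n] with [n > 0] even equals minus its
    rotation, hence vanishes, so only words of odd length survive. The bracket and
    the cobracket lower the total length by 2. Hence, to produce only words of odd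
    length, they must start from a word of even length; there the Koszul signs
    alternate along the rotations and the coefficients cancel. So [d f] and [f, f]
    are zero in the quotient for every [f], and the quantum master equation holds
    identically. *)

Set Implicit Arguments.
Unset Strict Implicit.
Unset Printing Implicit Defensive.

Import GRing.Theory.
Local Open Scope classical_set_scope.
Local Open Scope ring_scope.

Local Notation span := Defs.span.

(** * Spans and closed spans of relators *)

Section Span.
Context {X : choiceType} {wt : X -> nat} {R : (X -> rat) -> Prop}.

Lemma span_rel c r : R r -> span R (fun x => c * r x).
Proof.
move=> Rr; have := span_add c Rr (span_zero R).
by congr span; apply/funext => x; rewrite addr0.
Qed.

Lemma spanD f g : span R f -> span R g -> span R (fun x => f x + g x).
Proof.
elim=> [|c r f' Rr _ IH] sg.
  by move: sg; congr span; apply/funext => x; rewrite add0r.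
have := span_add c Rr (IH sg).
by congr span; apply/funext => x; rewrite addrA.
Qed.

Lemma spanZ c f : span R f -> span R (fun x => c * f x).
Proof.
elim=> [|b r f' Rr _ IH].
  by have := span_zero R; congr span; apply/funext => x; rewrite mulr0.
have := span_add (c * b) Rr IH.
by congr span; apply/funext => x; rewrite mulrDr mulrA.
Qed.

Lemma span_sum (I : eqType) (s : seq I) (F : I -> X -> rat) :
  (forall i, i \in s -> span R (F i)) -> span R (fun x => \sum_(i <- s) F i x).
Proof.
elim: s => [|i s IH] sF.
  by have := span_zero R; congr span; apply/funext => x; rewrite big_nil.
have si : span R (F i) by apply: sF; rewrite mem_head.
have ss : forall j, j \in s -> span R (F j).
  by move=> j js; apply: sF; rewrite in_cons js orbT.
have := spanD si (IH ss).
by congr span; apply/funext => x; rewrite big_cons.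
Qed.

Lemma closed_spanD f g : closed_span wt R f -> closed_span wt R g ->
  closed_span wt R (fun x => f x + g x).
Proof.
move=> sf sg N; have [f' sf' ef] := sf N; have [g' sg' eg] := sg N.
by exists (fun x => f' x + g' x); [exact: spanD|move=> x xN; rewrite ef ?eg].
Qed.

Lemma closed_spanZ c f : closed_span wt R f ->
  closed_span wt R (fun x => c * f x).
Proof.
move=> sf N; have [f' sf' ef] := sf N.
by exists (fun x => c * f' x); [exact: spanZ|move=> x xN; rewrite ef].
Qed.

(** Below each weight bound [f] is a finite combination of the [single y]; those with [f y = 0]
    contribute nothing, the others lie in the span. *)
Lemma closed_span_singles f :
    (forall N, finite_set [set x | (wt x < N)%N]) ->
    (forall x, f x != 0 -> span R (single x)) ->
  closed_span wt R f.
Proof.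
move=> fin sf N; have /finite_seqP[s es] := fin N.
exists (fun x => \sum_(y <- undup s) f y * single y x).
  apply: span_sum => y _; have [->|/sf] := eqVneq (f y) 0; last exact: spanZ.
  by have := span_zero R; congr span; apply/funext => x; rewrite mul0r.
move=> x xN; have xs : x \in undup s.
  by rewrite mem_undup; have : [set` s] x by rewrite -es.
rewrite (bigD1_seq x) ?undup_uniq //= /single eqxx mulr1 big1 ?addr0 // => y.
by rewrite eq_sym => /negPf ->; rewrite mulr0.
Qed.

End Span.

(** Injectivity of [e] leaves at most one nonzero term, so the sum, which defaults to 0 on infinite
    support, is safe for an arbitrary [a]. *)
Lemma fsbig_single (I X : choiceType) (A : set I) (a : I -> rat) (e : I -> X) i :
  injective e -> A i ->
  \sum_(p \in A) a p * single (e p) (e i) = a i.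
Proof.
move=> inj Ai; rewrite -(fsbig_widen [set i]); last first.
- move=> p /= [_ pi]; rewrite /single (inj_eq inj).
  by case: eqP => [ip|_]; [case: pi|rewrite mulr0].
- by move=> p /= ->.
by rewrite fsbig_set1 /single eqxx mulr1.
Qed.

Lemma fsbig_single_neq0 (I X : choiceType) (A : set I) (a : I -> rat)
    (e : I -> X) x :
  \sum_(p \in A) a p * single (e p) x != 0 ->
  exists i, [/\ A i, x = e i & a i != 0].
Proof.
apply: contraNP => nx; apply/eqP; rewrite fsbig1 // => p Ap.
have [->|ap] := eqVneq (a p) 0; first by rewrite mul0r.
rewrite /single; case: eqP => [xp|_]; last by rewrite mulr0.
by case: nx; exists p.
Qed.

(** * Koszul signs of odd symbols as inversion counts *)

Fixpoint inversions (s : seq nat) : nat :=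
  if s is x :: s' then (count (fun y => y < x)%N s' + inversions s')%N else 0.

(** Every reversed pair consists of odd symbols and costs -1. The bound on [s] matters because
    [nth false] reads an index beyond [k] as even. *)
Lemma koszul_odd k s : all (fun x => x < k)%N s ->
  koszul (nseq k true) s = (-1) ^+ inversions s.
Proof.
elim: s => [|x s IH] //= /andP[xk sk]; rewrite IH // exprD.
congr (_ ^+ _ * _); apply: eq_in_count => y ys.
by rewrite !nth_nseq xk (allP sk) // !andbT.
Qed.

Local Arguments koszul : simpl never.

Lemma inversions_cat_lt s1 s2 : allrel ltn s1 s2 ->
  inversions (s1 ++ s2) = (inversions s1 + inversions s2)%N.
Proof.
elim: s1 => [|x s1 IH] //; rewrite allrel_consl => /andP[/allP lx /IH /= ->].
rewrite count_cat (_ : count _ s2 = 0)%N ?addn0 ?addnA //.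
by apply/eqP; rewrite eqn0Ngt -has_count -all_predC; apply/allP => y /lx /=; lia.
Qed.

Lemma inversions_cat_gt s1 s2 : allrel (fun x y => y < x)%N s1 s2 ->
  inversions (s1 ++ s2)
  = (inversions s1 + inversions s2 + size s1 * size s2)%N.
Proof.
elim: s1 => [|x s1 IH]; first by rewrite mul0n addn0.
rewrite allrel_consl => /andP[lx /IH /= ->].
rewrite count_cat (_ : count _ s2 = size s2)%N; last by apply/eqP; rewrite -all_count.
by rewrite mulSn; lia.
Qed.

Lemma count_iota_geq x m k : (x <= m)%N ->
  count (fun y => y < x)%N (iota m k) = 0%N.
Proof. by elim: k m => [|k IH] m xm //=; rewrite IH; lia. Qed.

Lemma count_iota_ltn x m k : (m + k <= x)%N ->
  count (fun y => y < x)%N (iota m k) = k.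
Proof. by elim: k m => [|k IH] m xm //=; rewrite IH; lia. Qed.

Lemma inversions_iota m k : inversions (iota m k) = 0%N.
Proof. by elim: k m => [|k IH] m //=; rewrite IH count_iota_geq. Qed.

Lemma cut_iota i m n : (i < n)%N ->
  cut i (iota m n) = iota (m + i).+1 (n - i.+1) ++ iota m i.
Proof.
by move=> hi; rewrite /cut drop_iota take_iota (minn_idPl (ltnW hi)) addnS.
Qed.

Lemma inner_iota i j n : (i < j)%N -> (j < n)%N ->
  inner i j (iota 0 n) = iota i.+1 (j - i.+1).
Proof.
move=> ij jn; rewrite /inner drop_iota take_iota add0n (minn_idPl _) //.
exact: leq_sub2r (ltnW jn).
Qed.

Lemma outer_iota i j n : (i < j)%N -> (j < n)%N ->
  outer i j (iota 0 n) = iota j.+1 (n - j.+1) ++ iota 0 i.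
Proof.
move=> ij jn; rewrite /outer drop_iota take_iota add0n (minn_idPl _) //.
exact: ltnW (ltn_trans ij jn).
Qed.

(** [cut] exchanges two increasing blocks, so exactly the pairs across them are inverted. *)
Lemma inversions_cut i m n : (i < n)%N ->
  inversions (cut i (iota m n)) = ((n - i.+1) * i)%N.
Proof.
move=> hi; rewrite cut_iota // inversions_cat_gt ?inversions_iota ?size_iota //.
by apply/allrelP => x y; rewrite !mem_iota; lia.
Qed.

(** Moved to the front, [i] passes the [i] smaller indices, while [n + j] passes the [n.-1] left in
    the first word and [j] in the second. The two cuts stay in order and add their own
    inversions. *)
Lemma inversions_bracket i j n m : (i < n)%N -> (j < m)%N ->
  inversions [:: i, (n + j)%N & cut i (iota 0 n) ++ cut j (iota n m)]
  = (i + (n.-1 + j) + ((n - i.+1) * i + (m - j.+1) * j))%N.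
Proof.
move=> hi hj /=; rewrite inversions_cat_lt ?inversions_cut //; last first.
  by apply/allrelP => x y; rewrite !cut_iota // !mem_cat !mem_iota /=; lia.
rewrite !cut_iota // !count_cat add0n.
have -> : (n + j < i)%N = false by lia.
rewrite !(@count_iota_ltn _ 0 i) ?(@count_iota_ltn (n + j) i.+1); try lia.
rewrite !(@count_iota_geq i); try lia.
rewrite (@count_iota_geq _ (n + j).+1) ?(@count_iota_ltn _ n j); lia.
Qed.

(** [i] passes [i] indices; [j] passes only [j.-1], as [i] already stands before it. The last block
    [iota 0 i] is inverted with [inner] and with the first block of [outer]. *)
Lemma inversions_cobracket i j n : (i < j)%N -> (j < n)%N ->
  inversions [:: i, j & inner i j (iota 0 n) ++ outer i j (iota 0 n)]
  = (i + j.-1 + ((j - i.+1) * i + (n - j.+1) * i))%N.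
Proof.
move=> ij jn; rewrite inner_iota // outer_iota // catA /=.
rewrite inversions_cat_gt; last first.
  by apply/allrelP => x y; rewrite mem_cat !mem_iota; lia.
rewrite inversions_cat_lt; last first.
  by apply/allrelP => x y; rewrite !mem_iota /=; lia.
rewrite !inversions_iota !count_cat size_cat !size_iota mulnDl !add0n addnA.
congr (_ + _)%N.
rewrite !(@count_iota_ltn _ 0 i); try lia.
rewrite !(@count_iota_geq i) ?(@count_iota_ltn j i.+1) ?(@count_iota_geq j j.+1);
  lia.
Qed.

Lemma alternating_sum n : ~~ odd n -> \sum_(i < n) (-1) ^+ i = 0 :> rat.
Proof.
suff -> : \sum_(i < n) (-1) ^+ i = (odd n)%:R :> rat by move/negPf ->.
elim: n => [|n IH]; first by rewrite big_ord0.
rewrite big_ord_recr /= IH -signr_odd.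
by case: (odd n); rewrite /= ?expr1 ?expr0 ?subrr ?add0r.
Qed.

Lemma eq_signr (p q : nat) : odd p = odd q -> (-1) ^+ p = (-1) ^+ q :> rat.
Proof. by move=> e; rewrite -signr_odd e signr_odd. Qed.

Lemma half_double (x : rat) : 2%:R^-1 * (x + x) = x.
Proof. by rewrite -mulr2n -[x *+ 2]mulr_natl mulKf. Qed.

(** * Words in one odd letter *)

Section Line.
Notation word := (word (Pi line)).
Notation mono := (mono (Pi line)).
Notation series := (series (Pi line)).

Lemma letter_t (x : letter (Pi line)) : x = t.
Proof. exact: ord1. Qed.

Lemma eq_word (u v : word) : size u = size v -> u = v.
Proof.
elim: u v => [|x u IH] [|y v] //= [/IH ->].
by rewrite (letter_t x) (letter_t y).
Qed.

Lemma parsE (w : word) : pars w = nseq (size w) true.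
Proof. by elim: w => [|x w IH] //=; rewrite /pars /= -/(pars w) IH. Qed.

Lemma wparE (w : word) : wpar w = odd (size w).
Proof. by rewrite /wpar parsE count_nseq mul1n. Qed.

Definition odd_word (w : word) : bool := odd (size w).

Lemma odd_word_t_pow r : odd_word (t_pow r).
Proof. by rewrite /odd_word size_nseq /= odd_double. Qed.

Lemma t_pow_inj : injective t_pow.
Proof. by move=> r s /(congr1 size); rewrite !size_nseq; lia. Qed.

Lemma odd_wordE (w : word) : odd_word w -> w = t_pow (size w)./2.
Proof.
move=> ow; apply: eq_word; rewrite size_nseq.
by rewrite -[LHS]odd_double_half -/(odd_word w) ow.
Qed.

Lemma odd_words (ws : seq word) : all odd_word ws ->
  ws = map t_pow (map (fun w => (size w)./2) ws).
Proof.
move=> /allP ows; rewrite -map_comp map_id_in // => w /ows /odd_wordE {2}->.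
by [].
Qed.

Lemma mpar_t_pow rs : mpar (map t_pow rs) = false.
Proof.
rewrite /mpar count_map (eq_count (a2 := pred0)) ?count_pred0 // => r /=.
by rewrite /Pi_wpar wparE [odd _]odd_word_t_pow.
Qed.

(** * Vanishing of the structure maps on odd words *)

Lemma dual_form_line (x y : letter (Pi line)) : dual_form (Pi line) x y = 1.
Proof. by rewrite (letter_t x) (letter_t y) dual_form_t. Qed.

(* In even length, the rotation by [i] and the position [i] contribute the
   sign [(-1)^i] to the term of index [i]. *)
Lemma bracket_odd_word (a b u : word) : odd_word u -> bracket a b u = 0.
Proof.
move=> ou; apply/eqP; apply: contraT => /[dup] nz /bracket_size sz.
pose s (n i : nat) := (i + (n - i.+1) * i)%N.
have alt n : ~~ odd n -> \sum_(i < n) (-1) ^+ s n i = 0 :> rat.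
  move=> en; rewrite -[RHS](alternating_sum en); apply: eq_bigr => i _.
  apply: eq_signr; rewrite /s oddD oddM oddB //= (negPf en).
  by case: (odd i).
(* Each [cut i a ++ cut j b] has the length of [u], hence equals [u], and the sign splits into a
   factor in [i] and one in [j]: the double sum is a product. *)
have E : bracket a b u = (-1) ^+ (size a).-1 *
    ((\sum_(i < size a) (-1) ^+ s (size a) i) *
     (\sum_(j < size b) (-1) ^+ s (size b) j)).
  rewrite big_distrlr mulr_sumr; apply: eq_bigr => i _ /=.
  rewrite mulr_sumr; apply: eq_bigr => j _ /=.
  have hi := ltn_ord i; have hj := ltn_ord j.
  have -> : cut i a ++ cut j b = u.
    by apply: eq_word; rewrite size_cat; move: (size_cut hi) (size_cut hj); lia.
  rewrite /single eqxx mulr1 dual_form_line mulr1 parsE koszul_odd.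
    by rewrite inversions_bracket // -!exprD; congr (_ ^+ _); rewrite /s; lia.
  rewrite /= size_cat; apply/andP; split; first by lia.
  apply/andP; split; first by lia.
  by apply/allP => y; rewrite !cut_iota // !mem_cat !mem_iota; lia.
move: ou nz; rewrite /odd_word E => ou.
(* [size a + size b] is [size u + 2], hence odd, so one factor is an alternating sum of even
   length. *)
have /orP[/alt ->|/alt ->] : ~~ odd (size a) || ~~ odd (size b).
  by move: (congr1 odd sz); rewrite oddD /= ou; do 2!case: (odd _).
all: by rewrite ?mul0r !mulr0 eqxx.
Qed.

(* The terms with [inner] of a given odd length have alternating signs. *)
Lemma cobracket_odd_word (a u v : word) : odd_word u -> odd_word v ->
  cobracket a (u, v) = 0.
Proof.
move=> ou ov; have [//|/cobracket_size sz] := eqVneq (cobracket a (u, v)) 0.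
have hn : ((size v).+1 <= size a)%N by lia.
rewrite /cobracket.
(* For given [i] only [j = i + size u + 1] can produce [(u, v)], and [j < size a] forces
   [i <= size v]. This leaves [size v + 1] values of [i], an even number. *)
transitivity (\sum_(i < size a | (i < (size v).+1)%N) - (-1) ^+ i : rat); last first.
  by rewrite (big_ord_narrow hn) sumrN alternating_sum ?oppr0 //= negbK.
rewrite [RHS]big_mkcond; apply: eq_bigr => i _.
have inner_size (j : 'I_(size a)) : (i < j)%N ->
    size (inner i j a) = (j - i.+1)%N.
  move=> ij; have hj := ltn_ord j.
  by rewrite /inner size_take size_drop; case: ifP; lia.
have term0 (j : 'I_(size a)) : (i < j)%N -> (j : nat) != (i + (size u).+1)%N ->
    single (inner i j a, outer i j a) (u, v) = 0.
  move=> ij nj; rewrite /single; case: eqP => // -[eu _].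
  have su : size u = (j - i.+1)%N by rewrite -inner_size //; congr size.
  by case/eqP: nj; lia.
case: ifP => hi; last first.
  rewrite big1 // => j ij; rewrite term0 ?mulr0 //.
  by have hj := ltn_ord j; lia.
have hk : (i + (size u).+1 < size a)%N by lia.
rewrite (bigD1 (Ordinal hk)) /=; last by lia.
rewrite big1 ?addr0; last first.
  move=> j /andP[ij nj]; rewrite term0 ?mulr0 //.
have ik : (i < i + (size u).+1)%N by lia.
have hio := size_inner_outer ik hk.
have := inner_size (Ordinal hk) ik; rewrite /= => hin.
rewrite (_ : (inner _ _ a, outer _ _ a) = (u, v)); last first.
  by congr pair; apply: eq_word; lia.
rewrite /single eqxx mulr1 dual_form_line mulr1 parsE koszul_odd; last first.
  rewrite /= inner_iota // outer_iota //; apply/and3P; split=> //.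
  by apply/allP => y; rewrite !mem_cat !mem_iota; lia.
(* The exponent is [2i + size u + (size u + size v - i) * i], congruent to [1 + i] modulo 2 since
   both sizes are odd. *)
rewrite inversions_cobracket // -[RHS]mulN1r -exprS; apply: eq_signr.
rewrite -mulnDl.
have -> : (i + (size u).+1 - i.+1 + (size a - (i + (size u).+1).+1))%N
  = (size u + size v - i)%N by lia.
have -> : (i + (i + (size u).+1).-1)%N = (i.*2 + size u)%N by lia.
rewrite !oddD oddM oddB ?oddD ?odd_double /=; last by lia.
move: ou ov; rewrite /odd_word => -> ->.
by case: (odd i).
Qed.

(** The newly created words stand first in the output, so each term has as a factor a bracket or
    cobracket coefficient at odd words. The vanishing holds before passing to the quotient. *)
Lemma d_odd_words (f : series) (m : mono) : all odd_word m.2 -> d f m = 0.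
Proof.
case: m => i us /= ous; apply: fsbig1 => n _.
rewrite /mono_d /= (_ : mono_delta _ _ = 0); last first.
  case: us ous => [|u us] //= /andP[ou _].
  apply: big1 => j _; apply: big1 => k _.
  by rewrite /Pi_bracket bracket_odd_word // !(mulr0, mul0r).
rewrite (_ : mono_Delta _ _ = 0) ?mulr0 ?addr0 ?mulr0 //.
case: us ous => [|u [|v us]] //= /and3P[ou ov _].
apply: big1 => j _.
by rewrite /Pi_cobracket cobracket_odd_word // !(mulr0, mul0r).
Qed.

Lemma br_odd_words (f g : series) (m : mono) : all odd_word m.2 ->
  br f g m = 0.
Proof.
case: m => i [|u us] /= ous; apply: fsbig1 => n _; rewrite /mono_br /=.
  by rewrite !mulr0.
case/andP: ous => ou _; rewrite big1 ?mulr0 // => j _; apply: big1 => k _.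
by rewrite /Pi_bracket bracket_odd_word // !(mulr0, mul0r).
Qed.

(** * Vanishing of even words and equality in the quotients *)

(* Rotating a word of even positive length changes its sign. *)
Lemma span_even_word (w : word) : w != [::] -> ~~ odd_word w ->
  span (@rotation_rel (Pi line)) (single w).
Proof.
case: w => [|x w] // _; rewrite /odd_word /= negbK => ow.
have := span_rel 2%:R^-1 (RotationRel x w).
congr span; apply/funext => u.
have -> : rcons w x = x :: w by apply: eq_word; rewrite size_rcons.
by rewrite wparE ow (letter_t x) t_odd expr1 mulN1r opprK half_double.
Qed.

(** A monomial without words is a constant and an empty word is [nu]. A nonempty even word is minus
    its rotation, which is the same word, so dividing by 2 kills it. *)
Lemma span_not_odd_words (m : mono) :
  (m.2 = [::]) \/ ~~ all odd_word m.2 ->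
  span (@series_rel (Pi line)) (single m).
Proof.
have rel r : series_rel r -> span (@series_rel (Pi line)) r.
  move=> /(span_rel 1); congr span; apply/funext => x; exact: mul1r.
case: m => i ws /= [->|]; first exact/rel/SeriesConst.
case/allPn => w /path.splitPr[us vs].
case: w => [|x w].
  by move=> _; apply/rel/SeriesNu; rewrite mem_cat mem_head orbT.
rewrite /odd_word /= negbK => ow.
have := span_rel 2%:R^-1 (SeriesRotation i us x w vs).
congr span; apply/funext => u.
have -> : rcons w x = x :: w by apply: eq_word; rewrite size_rcons.
by rewrite wparE ow (letter_t x) t_odd expr1 mulN1r opprK half_double.
Qed.

(** The empty word is tested too: no rotation relator involves it, so here, unlike among the series,
    it survives. *)
Lemma h_eq_odd_words (g h : word -> rat) :
    (forall w, w = [::] \/ odd_word w -> g w = h w) -> h_eq g h.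
Proof.
move=> gh; apply: closed_span_singles => [N|w].
  apply: sub_finite_set (@finite_seq_le (letter (Pi line)) setT N finite_finset).
  by move=> w /= /ltnW.
rewrite subr_eq0 => nw; apply: span_even_word.
- by apply: contra nw => /eqP ->; rewrite gh //; left.
- by apply: contra nw => ow; rewrite gh //; right.
Qed.

Lemma series_eq_odd_words (f g : series) :
    (forall m, m.2 <> [::] -> all odd_word m.2 -> f m = g m) -> series_eq f g.
Proof.
move=> fg; apply: closed_span_singles => [N|m].
  apply: sub_finite_set (finite_mono_weight (Pi line) N).
  by move=> m /= /ltnW.
rewrite subr_eq0 => nm; apply: span_not_odd_words.
have [->|n0] := eqVneq m.2 [::]; first by left.
by right; apply: contra nm => om; rewrite fg //; exact/eqP.
Qed.

Lemma quantum_master_eq_line (f : series) : quantum_master_eq f.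
Proof.
apply: series_eq_odd_words => m _ om.
by rewrite d_odd_words // br_odd_words // mulr0 addr0.
Qed.

(** * Normal forms in words of odd length *)

Lemma series_eq_trans (f g k : series) :
  series_eq f g -> series_eq g k -> series_eq f k.
Proof.
move=> fg gk; have := closed_spanD fg gk; rewrite /series_eq.
by congr closed_span; apply/funext => m; rewrite subrKA.
Qed.

Lemma h_eq_trans (f g k : word -> rat) : h_eq f g -> h_eq g k -> h_eq f k.
Proof.
move=> fg gk; have := closed_spanD fg gk; rewrite /h_eq.
by congr closed_span; apply/funext => m; rewrite subrKA.
Qed.

Lemma h_eq_sym (f g : word -> rat) : h_eq f g -> h_eq g f.
Proof.
move=> /(closed_spanZ (-1)); rewrite /h_eq.
by congr closed_span; apply/funext => m; rewrite mulN1r opprB.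
Qed.

(** Reorderings of [rs] are kept as separate monomials; they agree modulo swaps, since odd words
    become even under parity reversion. An empty [rs] would give a constant. *)
Definition odd_series (a : nat -> seq nat -> rat) : series := fun m =>
  \sum_(p \in [set p : nat * seq nat | p.2 <> [::]])
     a p.1 p.2 * single (p.1, map t_pow p.2) m.

Lemma odd_seriesE a i rs : rs <> [::] ->
  odd_series a (i, map t_pow rs) = a i rs.
Proof.
move=> rs0.
apply: (@fsbig_single _ _ _ (fun p : nat * seq nat => a p.1 p.2)
  (fun p => (p.1, map t_pow p.2)) (i, rs)) => //.
by move=> [j u] [k v] /= [-> /(inj_map t_pow_inj) ->].
Qed.

Lemma odd_series_neq0 a m : odd_series a m != 0 ->
  exists i rs, [/\ rs <> [::], m = (i, map t_pow rs) & a i rs != 0].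
Proof.
move=> /(@fsbig_single_neq0 _ _ _ (fun p : nat * seq nat => a p.1 p.2)
  (fun p => (p.1, map t_pow p.2)))[[i rs] /= [rs0 -> ai]].
by exists i, rs.
Qed.

Lemma series_eq_odd_series (f : series) :
  series_eq f (odd_series (fun i rs => f (i, map t_pow rs))).
Proof.
apply: series_eq_odd_words => -[i ws] /= ws0 /odd_words ews.
by rewrite ews odd_seriesE //; case: ws ws0 {ews}.
Qed.

(** The only monomial of order below 2 that could occur is the single word [t] without [gamma], and
    [a0] removes it. *)
Lemma QME_solution_odd_series (f : series) a : a 0%N [:: 0%N] = 0 ->
  series_eq f (odd_series a) -> QME_solution f.
Proof.
move=> a0 fa; split; last exact: quantum_master_eq_line.
- exists (odd_series a) => // m /odd_series_neq0[i [rs [rs0 -> ai]]].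
  rewrite /Defs.order /tot_len.
  case: rs rs0 ai => [|r [|s rs]] //= _ ai; rewrite !size_nseq; last by lia.
  case: i ai => [|i] ai; last by lia.
  case: r ai => [|r] ai; last by lia.
  by rewrite a0 eqxx in ai.
- exists (odd_series a) => // m /odd_series_neq0[i [rs [_ -> _]]] /=.
  by rewrite mpar_t_pow.
Qed.

(** The length bound gives a representative [g] that is zero at the empty word and at [t]; even
    words vanish, which leaves [t_pow r] with [r >= 1]. *)
Lemma cyclic_Ainfty_odd_words (h : word -> rat) : cyclic_Ainfty h ->
  exists a : nat -> rat,
    h_eq h (fun w =>
      \sum_(r \in [set r : nat | (1 <= r)%N]) a r * single (t_pow r) w).
Proof.
case=> _ [g hg g2] _; exists (fun r => g (t_pow r)).
apply: h_eq_trans hg _; apply: h_eq_odd_words => w ow.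
have [r0|nr] := pselect (exists2 r, (1 <= r)%N & w = t_pow r).
  case: r0 => r r1 ->.
  by rewrite (@fsbig_single _ _ _ (fun r => g (t_pow r)) _ r t_pow_inj).
rewrite fsbig1; last first.
  move=> r /= r1; rewrite /single; case: eqP => [wr|_]; last by rewrite mulr0.
  by case: nr; exists r.
apply/eqP; apply: contra_notT nr => /g2 w2.
case: ow => [w0|/odd_wordE ew]; first by rewrite w0 in w2.
by exists (size w)./2 => //; lia.
Qed.

End Line.

Theorem mainTheorem5 :
  (forall f : series (Pi line),
      QME_solution f <->
      exists2 a : nat -> seq nat -> rat, a 0%N [:: 0%N] = 0 &
        series_eq f (fun m =>
          \sum_(p \in [set p : nat * seq nat | p.2 <> [::]])
             a p.1 p.2 * single (p.1, map t_pow p.2) m))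
  /\
  (forall h : word (Pi line) -> rat,
      cyclic_Ainfty h ->
      (exists a : nat -> rat,
          h_eq h (fun w =>
            \sum_(r \in [set r : nat | (1 <= r)%N]) a r * single (t_pow r) w))
      /\
      (exists2 f : series (Pi line),
          QME_solution f & h_eq (Lambda_to_h f) h)).
Proof.
split=> [f|h hA].
  split=> [[[g fg g2] _ _]|[a a0 fa]]; last exact: QME_solution_odd_series fa.
  (* Coefficients are read off the representative [g] supported in order at least 2, so the one at
     [t], of order 1, vanishes. *)
  exists (fun i rs => g (i, map t_pow rs)).
    by apply/eqP; apply: contraT => /g2.
  exact: series_eq_trans fg (series_eq_odd_series g).
have [a ha] := cyclic_Ainfty_odd_words hA; split; first by exists a.
(* [h] is placed at [gamma^0] on single words; the test [1 <= r] ensures [b 0 [:: 0] = 0]. *)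
pose b i rs : rat :=
  if (i, rs) is (0%N, [:: r]) then (if (1 <= r)%N then a r else 0) else 0.
exists (odd_series b).
  apply: (@QME_solution_odd_series _ b) => //.
  by apply: series_eq_odd_words.
apply: h_eq_trans (h_eq_sym ha); apply: h_eq_odd_words => w ow.
(* At the empty word and at [t] both sides are 0; at a longer odd word both are [a r]. *)
rewrite /Lambda_to_h; case: ow => [->|/odd_wordE ->].
  rewrite /= fsbig1 // => r _; by rewrite /single /= mulr0.
set r := (size w)./2; rewrite (@odd_seriesE b 0 [:: r]) // /b.
have [r1|r0] := leqP 1 r.
  rewrite (@fsbig_single _ _ _ a _ r t_pow_inj) // size_nseq.
  by case: ifP => //; lia.
rewrite if_same fsbig1 // => s /= s1; rewrite /single (inj_eq t_pow_inj).
by case: eqP => [rs|_]; [lia|rewrite mulr0].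
Qed.
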